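(* Let $\varphi$ be a renormalization of the finitely generated group $\Gamma$. Then $\varphi$ induces an injective homomorphism $\widehat{\varphi} \colon \widehat{\Gamma}_{\varphi} \to \widehat{\Gamma}_{\varphi}$ whose image is a clopen subgroup of $\widehat{\Gamma}_{\varphi}$; here ''induces'' means that $\widehat\varphi$ is continuous and $\widehat{\varphi}(\Phi_\varphi(g))=\Phi_\varphi(\varphi(g))$ for all $g\in\Gamma$.
   Context: A renormalization of a countable group $\Gamma$ is an injective homomorphism $\varphi\colon\Gamma\to\Gamma$ whose image is a proper subgroup of finite index. Put $\Gamma_0=\Gamma$, $\Gamma_\ell=\varphi^\ell(\Gamma)$, $X_\ell=\Gamma/\Gamma_\ell$ (left cosets), and let $X_\varphi=\varprojlim X_\ell$ be the inverse limit under the natural quotient maps $X_{\ell+1}\to X_\ell$; it is a Cantor space. The left translation actions of $\Gamma$ on the $X_\ell$ induce a minimal equicontinuous action $\Phi_\varphi\colon\Gamma\to\mathrm{Homeo}(X_\varphi)$. Let $\widehat{\Gamma}_\varphi$ be the closure of $\Phi_\varphi(\Gamma)$ in $\mathrm{Homeo}(X_\varphi)$ in the uniform topology; it is a profinite group. *)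

(* Defs.v *)
From HB Require Import structures.
From mathcomp Require Import all_boot.
From mathcomp Require Import generic_quotient monoid finmap.
From mathcomp Require Import all_classical topology.

Set Implicit Arguments.
Unset Strict Implicit.
Unset Printing Implicit Defensive.

Local Open Scope classical_set_scope.
Local Open Scope quotient_scope.
Local Open Scope group_scope.

Section FinitenessConditions.
Context {G : groupType}.

Definition subgroup (H : set G) : Prop := group_closed (mem H).

Definition finitely_generated : Prop :=
  exists s : seq G, smallest subgroup [set` s] = [set: G].

Definition left_cosets (H : set G) : set (set G) :=
  [set [set g * h | h in H] | g in [set: G]].

Definition finite_index (H : set G) : Prop := finite_set (left_cosets H).

Definition renormalization (phi : {multiplicative G -> G}) : Prop :=
  [/\ injective phi, range phi `<` [set: G] & finite_index (range phi)].

End FinitenessConditions.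
Arguments finitely_generated : clear implicits.

Section HomeoDef.
Context (T : uniformType).

(* [{uniform T -> T}] carries the uniformity of uniform convergence on [T]; it
   induces the uniform topology on the set of homeomorphisms *)
Definition homeomorphisms : set {uniform T -> T} :=
  [set f | exists g : T -> T,
    [/\ cancel f g, cancel g f, continuous (f : T -> T) & continuous g]].

Definition homeo : Type := homeomorphisms.

HB.instance Definition _ := Uniform.copy homeo (set_type homeomorphisms).

Definition homeo_fun (f : homeo) : T -> T := \val f.

End HomeoDef.
Coercion homeo_fun : homeo >-> Funclass.

Section HomeoGroup.
Context {T : uniformType}.
Implicit Types f g h : homeo T.

Lemma homeoP f g : f =1 g -> f = g.
Proof. by move=> fg; apply/val_inj/funext. Qed.

Definition mk_homeo (f : T -> T) (H : homeomorphisms f) : homeo T :=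
  exist _ (f : {uniform T -> T}) (mem_set H).

Definition homeo_inv_fun f : T -> T := projT1 (cid (set_mem (valP f))).

Lemma homeo_invP f : [/\ cancel f (homeo_inv_fun f), cancel (homeo_inv_fun f) f,
  continuous f & continuous (homeo_inv_fun f)].
Proof. exact: projT2 (cid (set_mem (valP f))). Qed.

Lemma homeo_id_subproof : homeomorphisms (id : T -> T).
Proof. by exists id; split=> // x; exact: cvg_id. Qed.

Lemma homeo_comp_subproof f g : homeomorphisms (f \o g).
Proof.
have [fK fVK fc fVc] := homeo_invP f; have [gK gVK gc gVc] := homeo_invP g.
exists (homeo_inv_fun g \o homeo_inv_fun f); split.
- exact: can_comp.
- exact: can_comp.
- by move=> x; apply: continuous_comp; [exact: gc|exact: fc].
- by move=> x; apply: continuous_comp; [exact: fVc|exact: gVc].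
Qed.

Lemma homeo_inv_subproof f : homeomorphisms (homeo_inv_fun f).
Proof. by have [? ? ? ?] := homeo_invP f; exists f. Qed.

Definition homeo_id : homeo T := mk_homeo homeo_id_subproof.
Definition homeo_comp f g : homeo T := mk_homeo (homeo_comp_subproof f g).
Definition homeo_inv f : homeo T := mk_homeo (homeo_inv_subproof f).

Lemma homeo_compA : associative homeo_comp.
Proof. by move=> f g h; apply: homeoP. Qed.
Lemma homeo_comp1f : left_id homeo_id homeo_comp.
Proof. by move=> f; apply: homeoP. Qed.
Lemma homeo_compf1 : right_id homeo_id homeo_comp.
Proof. by move=> f; apply: homeoP. Qed.
Lemma homeo_compVf : left_inverse homeo_id homeo_inv homeo_comp.
Proof. by move=> f; apply: homeoP => x; have [fK _ _ _] := homeo_invP f; exact: fK. Qed.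
Lemma homeo_compfV : right_inverse homeo_id homeo_inv homeo_comp.
Proof. by move=> f; apply: homeoP => x; have [_ fK _ _] := homeo_invP f; exact: fK. Qed.

HB.instance Definition _ := isGroup.Build (homeo T) homeo_compA
  homeo_comp1f homeo_compf1 homeo_compVf homeo_compfV.

Lemma homeoME f g x : homeo_fun (f * g) x = f (g x). Proof. by []. Qed.
Lemma homeo1E x : homeo_fun (1 : homeo T) x = x. Proof. by []. Qed.
Lemma homeoVK f : cancel (homeo_fun f^-1) f.
Proof. by move=> x; rewrite -homeoME mulgV. Qed.
Lemma homeoKV f : cancel f (homeo_fun f^-1).
Proof. by move=> x; rewrite -homeoME mulVg. Qed.

End HomeoGroup.

Section RenormalizationLimit.
Context {G : groupType} (phi : {multiplicative G -> G}).
Implicit Types (g h : G) (l n : nat).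

Definition Gamma_ l : set G := range (iter l phi).

Lemma mulphi1 : phi 1 = 1.
Proof. by apply: (@mulgI _ (phi 1)); rewrite -gmulfM !mulg1. Qed.

Lemma Gamma_1 l : Gamma_ l 1.
Proof. by exists 1 => //; elim: l => //= l ->; exact: mulphi1. Qed.

Lemma iter_phiM l : {morph iter l phi : g h / g * h}.
Proof. by move=> g h; elim: l => // l IH; rewrite !iterS IH gmulfM. Qed.

Lemma Gamma_M l g h : Gamma_ l g -> Gamma_ l h -> Gamma_ l (g * h).
Proof. by move=> [a _ <-] [b _ <-]; exists (a * b) => //; rewrite iter_phiM. Qed.

Lemma Gamma_V l g : Gamma_ l g -> Gamma_ l g^-1.
Proof.
move=> [a _ <-]; exists a^-1 => //; apply: (@mulgI _ (iter l phi a)).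
rewrite -iter_phiM !mulgV; elim: l => //= l ->; exact: mulphi1.
Qed.

Lemma Gamma_S l : Gamma_ l.+1 `<=` Gamma_ l.
Proof. by move=> _ [a _ <-]; exists (phi a) => //; rewrite iterSr. Qed.

Definition coset_rel l : rel G := fun g h => `[< Gamma_ l (g^-1 * h) >].

Lemma coset_rel_refl l : reflexive (coset_rel l).
Proof. by move=> g; apply/asboolP; rewrite mulVg; exact: Gamma_1. Qed.

Lemma coset_rel_sym l : symmetric (coset_rel l).
Proof.
by move=> g h; apply/asboolP/asboolP => /Gamma_V; rewrite invgM invgK.
Qed.

Lemma coset_rel_trans l : transitive (coset_rel l).
Proof.
move=> h g k /asboolP gh /asboolP hk; apply/asboolP.
by have := Gamma_M gh hk; rewrite mulgA mulgK.
Qed.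

Canonical coset_equiv l :=
  EquivRel (coset_rel l) (coset_rel_refl l) (coset_rel_sym l)
    (@coset_rel_trans l).

Definition X_ l := {eq_quot coset_equiv l}.

HB.instance Definition _ l := Choice.on (X_ l).
HB.instance Definition _ l := Quotient.on (X_ l).
HB.instance Definition _ l := EqQuotient.on (X_ l).

(* [repr] only selects representatives: [X_projE] and [X_actE] below show that
   [X_proj] and [X_act] do not depend on the choice *)
Lemma X_eqP l g h : \pi_(X_ l) g = \pi_(X_ l) h <-> Gamma_ l (g^-1 * h).
Proof.
split; first by move/eqP; rewrite eqquotE => /asboolP.
by move=> gh; apply/eqP; rewrite eqquotE; apply/asboolP.
Qed.

Definition X_proj l (c : X_ l.+1) : X_ l := \pi_(X_ l) (repr c).

Lemma X_projE l g : X_proj (\pi_(X_ l.+1) g) = \pi_(X_ l) g.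
Proof.
by apply/X_eqP/Gamma_S/(X_eqP l.+1 _ _).1; rewrite reprK.
Qed.

Definition X_act l g (c : X_ l) : X_ l := \pi_(X_ l) (g * repr c).

Lemma X_actE l g h : X_act g (\pi_(X_ l) h) = \pi_(X_ l) (g * h).
Proof.
apply/X_eqP; rewrite invgM mulgA mulgVK.
by apply/(X_eqP l _ _).1; rewrite reprK.
Qed.

Lemma X_act1 l : @X_act l 1 =1 id.
Proof. by move=> c; rewrite -[c]reprK X_actE mul1g. Qed.

Lemma X_actM l g h (c : X_ l) : X_act (g * h) c = X_act g (X_act h c).
Proof. by rewrite -[c]reprK (X_actE _ (g * h)) (X_actE _ h) (X_actE _ g) mulgA. Qed.

Lemma X_proj_act l g (c : X_ l.+1) : X_proj (X_act g c) = X_act g (X_proj c).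
Proof. by rewrite -[c]reprK (X_actE _ g) !X_projE (X_actE _ g). Qed.

Definition compatible_seqs : set (prod_topology (fun l => discrete_topology (X_ l))) :=
  [set x : forall l, X_ l | forall l, X_proj (x l.+1) = x l].

Definition X_lim : Type := compatible_seqs.

HB.instance Definition _ := Uniform.copy X_lim (set_type compatible_seqs).

Definition coord l (x : X_lim) : X_ l := \val x l.

Lemma coord_proj l x : X_proj (coord l.+1 x) = coord l x.
Proof. exact: (set_mem (valP x)) l. Qed.

Lemma coordP x y : (forall l, coord l x = coord l y) -> x = y.
Proof. by move=> xy; apply/val_inj/functional_extensionality_dep. Qed.

Lemma coord_le l n x y :
  (l <= n)%N -> coord n x = coord n y -> coord l x = coord l y.
Proof.
move=> /subnK <-; elim: (n - l)%N => // k IH xy; apply: IH.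
by rewrite -(coord_proj _ x) -(coord_proj _ y); congr X_proj.
Qed.

Lemma X_lim_entourageP (E : set (X_lim * X_lim)) :
  entourage E <-> exists n, forall x y, coord n x = coord n y -> E (x, y).
Proof.
split=> [[V [W [F _ FW] WV] VE]|[n nE]].
  have lvl p : exists n, p \in F -> forall x y : X_lim,
      coord n x = coord n y -> (projT1 p).2 (\val x, \val y).
    case: p => [[i B] pB]; have /asboolP/= [D dD DB] := pB.
    exists i => _ x y xy; apply: DB; apply: dD => /=.
    by exists (coord i x) => //; congr pair.
  have [N NP] := choice lvl.
  exists (\max_(p <- F) N p) => x y xy; apply/VE/WV; rewrite -FW => p pF.
  apply: (NP p pF); apply: coord_le xy.
  exact: (@leq_bigmax_seq _ _ xpredT).
pose D : set (prod_topology (fun l => discrete_topology (X_ l)) * 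
  prod_topology (fun l => discrete_topology (X_ l))) :=
  [set xy | xy.1 n = xy.2 n].
exists D; last by move=> [x y] xy; exact: nE.
have entD : `[< @entourage (initial_topology
    (@proj nat (fun l => discrete_topology (X_ l)) n)) D >].
  apply/asboolP; exists [set xy | xy.1 = xy.2]; last by [].
  have : @entourage (discrete_topology (X_ n)) [set xy | xy.1 = xy.2].
    by rewrite uniform_discrete => _ [z _ <-].
  exact.
exists D => //.
by refine (@finI_from1 _ _ setT _ (exist _ ((n : {classic nat}), D) entD) _).
Qed.

Lemma X_lim_nbhsP x (U : set X_lim) :
  nbhs x U <-> exists n, forall y, coord n x = coord n y -> U y.
Proof.
split=> [/nbhsP[E /X_lim_entourageP[n nE] EU]|[n nU]].
  by exists n => y xy; apply: EU; apply/xsectionP/nE.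
apply/nbhsP; exists [set xy | coord n xy.1 = coord n xy.2].
  by apply/X_lim_entourageP; exists n.
by move=> y /xsectionP; exact: nU.
Qed.

Lemma homeo_nbhsP (f : homeo X_lim) (P : set (homeo X_lim)) :
  nbhs f P <-> exists n, forall h : homeo X_lim,
    (forall x, coord n (f x) = coord n (h x)) -> P h.
Proof.
split.
  case=> _ [[Q oQ <-] Qf QP].
  have /uniform_nbhs[E [/X_lim_entourageP[n nE] EQ]] : nbhs (\val f) Q.
    exact: open_nbhs_nbhs.
  by exists n => h fh; apply/QP/EQ => x _; exact/nE/fh.
move=> [n nP].
have [V [oV Vf VP]] : exists V : set {uniform X_lim -> X_lim},
    [/\ open V, V (\val f) &
        V `<=` [set h | forall x, coord n (f x) = coord n (h x)]].
  suff : nbhs (\val f)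
     ([set h | forall x, coord n (f x) = coord n (h x)] : set {uniform X_lim -> X_lim}).
    by rewrite nbhsE => -[V [oV Vf] VP]; exists V.
  apply/uniform_nbhs; exists [set xy | coord n xy.1 = coord n xy.2]; split.
    by apply/X_lim_entourageP; exists n.
  by move=> h fh x; exact: fh.
exists (set_val @^-1` V); split => //; first by exists V.
by move=> h /VP; exact: nP.
Qed.

Definition Phi_fun g (x : X_lim) : X_lim.
Proof.
exists (fun l => X_act g (coord l x)); apply/mem_set => l.
by rewrite X_proj_act coord_proj.
Defined.

Lemma coord_Phi_fun l g x : coord l (Phi_fun g x) = X_act g (coord l x).
Proof. by []. Qed.

Lemma Phi_subproof g : homeomorphisms (Phi_fun g).
Proof.
have PhiK h : cancel (Phi_fun h) (Phi_fun h^-1).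
  by move=> x; apply: coordP => l; rewrite !coord_Phi_fun -X_actM mulVg X_act1.
have Phi_cont h : continuous (Phi_fun h).
  move=> x U /X_lim_nbhsP[n nU]; apply/X_lim_nbhsP; exists n => y xy.
  by apply: nU; rewrite !coord_Phi_fun xy.
exists (Phi_fun g^-1); split=> //; by rewrite -{2}[g]invgK.
Qed.

Definition Phi g : homeo X_lim := mk_homeo (Phi_subproof g).

Lemma coord_Phi l g x : coord l (Phi g x) = X_act g (coord l x).
Proof. by []. Qed.

Lemma PhiM : {morph Phi : g h / g * h}.
Proof. by move=> g h; apply: homeoP => x; apply: coordP => l; exact: X_actM. Qed.

HB.instance Definition _ := isMultiplicative.Build G (homeo X_lim) Phi PhiM.

Definition closure_Phi : set (homeo X_lim) := closure (range Phi).

Lemma closure_PhiP (f : homeo X_lim) :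
  closure_Phi f <->
  forall n, exists g, forall x, coord n (f x) = X_act g (coord n x).
Proof.
split=> [cf n|cf B /homeo_nbhsP[n nB]].
  have [|_ [[g _ <-] fg]] := cf [set h : homeo X_lim | forall x,
      coord n (f x) = coord n (h x)].
    by apply/homeo_nbhsP; exists n.
  by exists g.
by have [g fg] := cf n; exists (Phi g); split; [exists g|exact: nB].
Qed.

Lemma closure_Phi_group_closed : group_closed (mem closure_Phi).
Proof.
split=> [|f h /set_mem/closure_PhiP cf /set_mem/closure_PhiP ch].
  by apply/mem_set/closure_PhiP => n; exists 1 => x; rewrite X_act1.
apply/mem_set/closure_PhiP => n.
have [a fa] := cf n; have [b hb] := ch n; exists (a * b^-1) => x.
rewrite homeoME fa X_actM; congr X_act.
by rewrite -{2}(homeoVK h x) hb -X_actM mulVg X_act1.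
Qed.

Definition Gamma_hat : Type := closure_Phi.

HB.instance Definition _ := Uniform.copy Gamma_hat (set_type closure_Phi).
HB.instance Definition _ :=
  SubChoice.copy Gamma_hat (set_type closure_Phi).
HB.instance Definition _ :=
  SubChoice_isSubGroup.Build (homeo X_lim) _ Gamma_hat closure_Phi_group_closed.

Definition Phi_hat g : Gamma_hat :=
  exist _ (Phi g) (mem_set (@subset_closure _ (range Phi) _ (imageT Phi g))).

End RenormalizationLimit.

Arguments closure_Phi {G} phi _.
Arguments compatible_seqs {G} phi _.

(* Main.v *)
Require Import Defs.
From HB Require Import structures.
From mathcomp Require Import all_boot.
From mathcomp Require Import fingroup perm.
From mathcomp Require Import generic_quotient monoid.
From mathcomp Require Import all_classical topology.

(** Write C_n for the kernel of the action of G on X_n = G / phi^n(G). An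
    element of the closure Gamma_hat is determined by which class of G modulo
    C_n it acts as on X_n, for each n, and conversely every coherent sequence
    of such classes comes from an element ([Gamma_hat_complete]). So phi
    extends to a continuous endomorphism as soon as

      for every n there is m with phi(C_m) contained in C_n,

    which is [phi_uniformly_continuous], the heart of the proof. It is not
    formal: C_n is the intersection of all conjugates of phi^n(G), and phi only
    sees the conjugates by elements of phi(G). What is formal is the opposite
    inclusion, that C_(n+1) is contained in phi(C_n); it gives the injectivity
    of the extension, and shows that the image of the extension is the
    stabilizer of the base coset phi(G) in X_1, which is clopen.

    The hard inclusion comes from the formal one by counting. Let rho be the
    homomorphism from G to the finite group of permutations of X_n. Since G is
    finitely generated, there are only finitely many homomorphisms from G to
    that group, hence the sequence rho o phi^j takes finitely many values, and
    R(g) = (rho(phi^j(g)))_j defines a homomorphism R from G onto a finite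
    group on which phi induces a map sigma. The finite sets R(C_m) decrease, so
    they are equal to a fixed K for large m. The formal inclusion gives that K
    is contained in sigma(K), so K = sigma(K) by cardinality. Therefore, for m
    large and g in C_m, R(phi(g)) is in K = R(C_n'), with n' >= n, and its
    component of index 0 says that rho(phi(g)) is trivial. *)

Set Implicit Arguments.
Unset Strict Implicit.
Unset Printing Implicit Defensive.

Local Open Scope classical_set_scope.
Local Open Scope group_scope.

(** * Finite sets and homomorphisms *)

Lemma finite_set_bijective (T : choiceType) : finite_set [set: T] ->
  exists (F : finType) (e : T -> F), bijective e.
Proof.
move=> /finite_seqP[s sT].
have sP x : x \in s by have : [set` s] x by rewrite -sT.
exists (seq_sub s), (fun x => SeqSub (sP x)), val => [x //|x]; exact: val_inj.
Qed.

Lemma morphM_1 (G H : groupType) (f : G -> H) :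
  {morph f : x y / x * y} -> f 1 = 1.
Proof. by move=> fM; apply: (@mulgI _ (f 1)); rewrite -fM !mulg1. Qed.

Lemma morphM_V (G H : groupType) (f : G -> H) :
  {morph f : x y / x * y} -> {morph f : x / x^-1}.
Proof.
by move=> fM x; apply: (@mulgI _ (f x)); rewrite -fM !mulgV morphM_1.
Qed.

Lemma subgroup_range (G H : groupType) (f : {multiplicative G -> H}) :
  subgroup (range f).
Proof.
split; first by apply/mem_set; exists 1 => //; apply: morphM_1; exact: gmulfM.
move=> _ _ /set_mem[x _ <-] /set_mem[y _ <-]; apply/mem_set.
by exists (x * y^-1) => //; rewrite gmulfM (morphM_V (@gmulfM _ _ f)).
Qed.

Lemma eq_on_generators (G H : groupType) (f g : G -> H) (s : seq G) :
  {morph f : x y / x * y} -> {morph g : x y / x * y} ->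
  smallest subgroup [set` s] = [set: G] ->
  (forall x, x \in s -> f x = g x) -> f =1 g.
Proof.
move=> fM gM sG fg x; have : smallest subgroup [set` s] x by rewrite sG.
apply: (@smallest_sub _ _ _ [set x | f x = g x]) => //.
split; first by apply/mem_set; rewrite /= (morphM_1 fM) (morphM_1 gM).
move=> y z /set_mem/= fy /set_mem/= fz; apply/mem_set => /=.
by rewrite fM gM (morphM_V fM) (morphM_V gM) fy fz.
Qed.

Lemma sequence_repeats (F : finType) (h : nat -> F) :
  exists a b, (a < b)%N /\ h a = h b.
Proof.
apply: contrapT => nrep.
have hinj : injective (fun i : 'I_#|F|.+1 => h i).
  move=> i j hij; case: (ltngtP i j) => [ij|ji|/val_inj//].
  - by case: nrep; exists i, j.
  - by case: nrep; exists j, i.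
by have := leq_card _ hinj; rewrite card_ord ltnn.
Qed.

Lemma decreasing_stable (F : finType) (K : nat -> {set F}) :
  (forall m, K m.+1 \subset K m) ->
  exists m, forall n, (m <= n)%N -> K n = K m.
Proof.
move=> Kdec.
have Kle m n : (m <= n)%N -> K n \subset K m.
  move/subnK <-; elim: (n - m)%N => // k; apply: fintype.subset_trans.
  exact: Kdec.
have [|c /asboolP[m mc] cmin] := @ex_minnP (fun c => `[< exists m, #|K m| = c >]).
  by exists #|K 0%N|; apply/asboolP; exists 0%N.
exists m => n mn; apply/eqP; rewrite eqEcard Kle// mc; apply: cmin.
by apply/asboolP; exists n.
Qed.

Section Endomorphism.
Context {G : groupType} (phi : {multiplicative G -> G}).

(** The homomorphisms rho o phi^j are determined by their values on a finite
    generating set, so two of them coincide; composing with powers of phi, the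
    whole sequence is then eventually periodic. *)
Lemma hom_iter_periodic (S : finGroupType) (rho : G -> S) :
  {morph rho : x y / x * y} -> finitely_generated G ->
  exists a b, (a < b)%N /\
    forall k x, rho (iter (a + k) phi x) = rho (iter (b + k) phi x).
Proof.
move=> rhoM [s sG].
pose h j := [ffun i : 'I_(size s) => rho (iter j phi (nth 1 s i))].
have [a [b [ab hab]]] := sequence_repeats h.
exists a, b; split=> // k x; rewrite !iterD; move: (iter k phi x).
apply: (eq_on_generators _ _ sG) => [y z|y z|y ys].
- by rewrite iter_phiM rhoM.
- by rewrite iter_phiM rhoM.
have ysz : (index y s < size s)%N by rewrite index_mem.
by move/ffunP/(_ (Ordinal ysz)): hab; rewrite !ffunE /= nth_index.
Qed.

(** A chain that phi expands (each term lies in the phi-image of the preceding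
    one) stabilizes in any finite quotient on which phi acts, and there phi
    must map the stable value onto itself. The quotient used is given by the
    components rho o phi^j for j < b; by periodicity these determine the
    components for all j, so that phi does act on it. *)
Lemma chain_image_in_kernel (S : finGroupType) (rho : G -> S)
    (C : nat -> set G) n :
  {morph rho : x y / x * y} -> finitely_generated G ->
  (forall m, C m.+1 `<=` C m) -> (forall m, C m.+1 `<=` phi @` C m) ->
  (forall x, C n x -> rho x = 1) ->
  exists m, forall x, C m x -> rho (phi x) = 1.
Proof.
move=> rhoM fgG Cdec Cphi Cn1.
have [a [b [ab rab]]] := hom_iter_periodic rhoM fgG.
pose R x := [ffun j : 'I_b => rho (iter j phi x)].
have RE x y : R x = R y -> forall j, rho (iter j phi x) = rho (iter j phi y).
  move=> Rxy; elim/ltn_ind => j IH; have [jb|bj] := ltnP j b.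
    by move/ffunP/(_ (Ordinal jb)): Rxy; rewrite !ffunE.
  rewrite -(subnKC bj) -!rab; apply: IH.
  by rewrite -{2}(subnKC bj) ltn_add2r.
have Rphi x y : R x = R y -> R (phi x) = R (phi y).
  by move=> /RE Rxy; apply/ffunP => j; rewrite !ffunE -!iterSr.
pose K m := [set v | `[< exists2 x, C m x & R x = v >]]%SET.
have KP m v : reflect (exists2 x, C m x & R x = v) (v \in K m).
  by rewrite inE; exact: asboolP.
have Kdec m : K m.+1 \subset K m.
  by apply/fintype.subsetP => v /KP[x Cx xv]; apply/KP; exists x => //; exact: Cdec.
have [m mK] := decreasing_stable Kdec.
pose sigma v := R (phi (xget 1 [set x | R x = v])).
have sigmaE x : sigma (R x) = R (phi x).
  by apply: Rphi; apply: (@xgetPex _ 1 [set y | R y = R x]); exists x.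
have Ksigma : K m = (sigma @: K m)%SET.
  apply/eqP; rewrite eqEcard leq_imset_card andbT.
  rewrite -{1}(mK m.+1)//; apply/fintype.subsetP => v /KP[x /Cphi[y Cy <-] <-].
  by rewrite -sigmaE; apply: imset_f; apply/KP; exists y.
exists m => x Cx.
have : R (phi x) \in K (maxn m n).
  rewrite mK ?leq_maxl// Ksigma -sigmaE; apply: imset_f.
  by apply/KP; exists x.
move=> /KP[c Cc /RE/(_ 0%N)/= <-]; apply: Cn1.
elim: (maxn m n) (leq_maxr m n) Cc => [|k IH].
  by rewrite leqn0 => /eqP ->.
by rewrite leq_eqVlt => /predU1P[-> //|nk /Cdec]; exact: IH.
Qed.

End Endomorphism.

Section Renormalization.
Context {G : groupType} (phi : {multiplicative G -> G}).
Local Open Scope quotient_scope.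
Local Open Scope group_scope.

(** * The actions on the coset spaces *)

(** With t in G a representative of a class of X_1, the cosets of phi^(l+1)(G)
    inside g phi^l(G) are the g phi^l(t) phi^(l+1)(G). *)
Lemma finite_coset_space l :
  finite_index (range phi) -> finite_set [set: X_ phi l].
Proof.
move=> finI; pose coset (c : X_ phi 1) : set G := [set repr c * h | h in range phi].
have fin1 : finite_set [set: X_ phi 1].
  have -> : [set: X_ phi 1] = coset @^-1` left_cosets (range phi).
    by apply/seteqP; split=> // c _; exists (repr c).
  apply: finite_preimage finI => c d _ _ cd.
  have : coset c (repr c) by exists 1; rewrite ?mulg1//; exact: (Gamma_1 phi 1).
  rewrite cd => -[_ [g _ <-] dc].
  rewrite -[c]reprK -[d]reprK; apply/esym/X_eqP; exists g => //.
  by rewrite -dc mulKg.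
elim: l => [|l IH].
  apply: sub_finite_set (finite_set1 (\pi_(X_ phi 0) 1)) => c _ /=.
  by rewrite -[c]reprK; apply/X_eqP; exists ((repr c)^-1 * 1).
apply: sub_finite_set
  (finite_image2 (fun (c : X_ phi l) (t : X_ phi 1) =>
     \pi_(X_ phi l.+1) (repr c * iter l phi (repr t))) IH fin1) => c _.
have /X_eqP[a _ ra] : \pi_(X_ phi l) (repr (\pi_(X_ phi l) (repr c))) =
    \pi_(X_ phi l) (repr c) by rewrite reprK.
have /X_eqP[b _ tb] :
    \pi_(X_ phi 1) (repr (\pi_(X_ phi 1) a)) = \pi_(X_ phi 1) a.
  by rewrite reprK.
exists (\pi_(X_ phi l) (repr c)) => //; exists (\pi_(X_ phi 1) a) => //.
rewrite -[RHS]reprK; apply/X_eqP; exists b => //.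
rewrite iterSr [phi b]tb; apply: (canRL (mulKg _)).
by rewrite -mulgA -iter_phiM mulVKg ra mulVKg.
Qed.

Definition same_action n (g h : G) : Prop :=
  forall c : X_ phi n, X_act g c = X_act h c.

Definition level_kernel n : set G := [set g | same_action n g 1].

Lemma same_actionP n g h :
  same_action n g h <-> forall k, Gamma_ phi n ((g * k)^-1 * (h * k)).
Proof.
split=> [gh k|gh c].
  by apply/X_eqP; rewrite -!X_actE gh.
by rewrite -[c]reprK !X_actE; apply/X_eqP.
Qed.

Lemma same_action_kernel n g h :
  same_action n g h <-> level_kernel n (g^-1 * h).
Proof.
split=> gh c; first by rewrite X_actM -gh -X_actM mulVg.
by rewrite -{1}[c]X_act1 -(gh c) -X_actM mulVKg.
Qed.

Lemma same_action_pred n g h : same_action n.+1 g h -> same_action n g h.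
Proof.
by move=> /same_actionP gh; apply/same_actionP => k; exact: Gamma_S.
Qed.

Lemma same_action_le n m g h :
  (n <= m)%N -> same_action m g h -> same_action n g h.
Proof. by move/subnK <-; elim: (m - n)%N => // k IH /same_action_pred. Qed.

Lemma same_actionV n g h : same_action n g h -> same_action n g^-1 h^-1.
Proof.
move=> gh c; rewrite -{1}[c]X_act1 -(mulgV h) X_actM -gh.
by rewrite -X_actM mulVg X_act1.
Qed.

(** By injectivity, phi identifies X_n with the set of cosets in X_(n+1) that
    meet phi(G), and the action of G on X_n with that of phi(G) on this set. *)
Lemma same_action_of_image n g h : injective phi ->
  same_action n.+1 (phi g) (phi h) -> same_action n g h.
Proof.
move=> phi_inj /same_actionP gh; apply/same_actionP => k.
have [a _ ak] := gh (phi k).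
by exists a => //; apply: phi_inj; rewrite -iterS ak !(gmulfM, morphM_V (@gmulfM _ _ phi)).
Qed.

Lemma level_kernel_expand n :
  injective phi -> level_kernel n.+1 `<=` phi @` level_kernel n.
Proof.
move=> phi_inj g g1; have /X_eqP : \pi_(X_ phi 1) 1 = \pi_(X_ phi 1) g.
  by rewrite -[in RHS](mulg1 g) -X_actE (@same_action_le 1 n.+1 g 1)// X_act1.
rewrite invg1 mul1g => -[a _ ag].
exists a => //; apply: same_action_of_image phi_inj _.
by rewrite mulphi1 [phi a]ag.
Qed.

Lemma permutation_representation n : finite_index (range phi) ->
  exists (S : finGroupType) (rho : G -> S),
    {morph rho : x y / x * y} /\ forall g, rho g = 1 <-> level_kernel n g.
Proof.
move=> finI.
have [F [e [e' eK e'K]]] := finite_set_bijective (finite_coset_space n finI).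
(* Products of permutations apply the left factor first, whence the inverse. *)
pose r g i := e (X_act g^-1 (e' i)).
have rinj g : injective (r g).
  apply: (can_inj (g := r g^-1)) => i.
  by rewrite /r eK -X_actM mulVg X_act1 e'K.
exists {perm F}, (fun g => perm (rinj g)); split=> [g h|g].
  by apply/permP => i; rewrite permM !permE /r eK -X_actM invgM.
split=> [/permP g1|g1].
  suff /same_actionV : same_action n g^-1 1 by rewrite invgK invg1.
  move=> c; have := g1 (e c); rewrite permE perm1 /r eK => /(can_inj eK) ->.
  by rewrite X_act1.
apply/permP => i; rewrite permE perm1 /r -[RHS]e'K; congr e.
by rewrite (same_actionV g1) invg1 X_act1.
Qed.

(** The subgroups C_n form a neighbourhood basis of the identity for the
    topology on G inherited from Gamma_hat: this is the continuity of phi. *)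
Lemma phi_uniformly_continuous n :
  finitely_generated G -> injective phi -> finite_index (range phi) ->
  exists m, forall g h, same_action m g h -> same_action n (phi g) (phi h).
Proof.
move=> fgG phi_inj finI.
have [S [rho [rhoM rho1]]] := permutation_representation n finI.
have [m mP] := chain_image_in_kernel rhoM fgG
  (fun m g => @same_action_pred m g 1)
  (fun m => @level_kernel_expand m phi_inj) (fun g => (rho1 g).2).
exists m => g h /same_action_kernel gh; apply/same_action_kernel.
by rewrite -(morphM_V (@gmulfM _ _ phi)) -gmulfM; apply/rho1/mP.
Qed.

(** * Elements of the closure as coherent sequences *)

Definition acts_as n (f : Gamma_hat phi) g :=
  forall x, coord n (homeo_fun (val f) x) = X_act g (coord n x).

Definition coset_pt (g : G) : X_lim phi.
Proof.
by exists (fun l => \pi_(X_ phi l) g); apply/mem_set => l; exact: X_projE.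
Defined.

Lemma coord_pt n g : coord n (coset_pt g) = \pi_(X_ phi n) g.
Proof. by []. Qed.

Lemma acts_as_exists f n : exists g, acts_as n f g.
Proof. by have /set_mem/closure_PhiP := valP f; exact. Qed.

(** Every point of X_n is a coordinate of some point of the limit. *)
Lemma acts_as_same n f g h : acts_as n f g -> acts_as n f h -> same_action n g h.
Proof. by move=> fg fh c; rewrite -[c]reprK -coord_pt -fg fh. Qed.

Lemma same_acts_as n f g h : same_action n g h -> acts_as n f g -> acts_as n f h.
Proof. by move=> gh fg x; rewrite fg. Qed.

Lemma acts_as_le n m f g : (n <= m)%N -> acts_as m f g -> acts_as n f g.
Proof.
by move=> nm fg x; rewrite -coord_Phi; apply: coord_le nm _; rewrite fg.
Qed.

Lemma acts_as_common m n f : exists g, acts_as m f g /\ acts_as n f g.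
Proof.
have [g fg] := acts_as_exists f (maxn m n).
by exists g; split; apply: acts_as_le fg; [exact: leq_maxl|exact: leq_maxr].
Qed.

Lemma acts_as_eq f f' :
  (forall n, exists g, acts_as n f g /\ acts_as n f' g) -> f = f'.
Proof.
move=> ff'; apply/val_inj/homeoP => x; apply: coordP => n.
by have [g [-> ->]] := ff' n.
Qed.

Lemma acts_asM n f f' g g' :
  acts_as n f g -> acts_as n f' g' -> acts_as n (f * f') (g * g').
Proof. by move=> fg fg' x; rewrite X_actM -fg' -fg. Qed.

Lemma acts_as_Phi n g : acts_as n (Phi_hat phi g) g.
Proof. by []. Qed.

Lemma Gamma_hat_complete (a : nat -> G) :
  (forall n, same_action n (a n) (a n.+1)) -> exists f, forall n, acts_as n f (a n).
Proof.
move=> aP.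
have compat (b : nat -> G) (bP : forall n, same_action n (b n) (b n.+1)) x :
    compatible_seqs phi (fun n => X_act (b n) (coord n x)).
  by move=> n; rewrite X_proj_act coord_proj bP.
pose F b bP x : X_lim phi :=
  exist (fun y => y \in compatible_seqs phi) _ (mem_set (compat b bP x)).
have Fc b bP : continuous (F b bP).
  move=> x U /X_lim_nbhsP[n nU]; apply/X_lim_nbhsP; exists n => y xy.
  by apply: nU; rewrite /coord/= -!/(coord _ _) xy.
have aVP n := same_actionV (aP n).
have hF : homeomorphisms (F a aP).
  exists (F (fun n => (a n)^-1) aVP); split=> //.
  - move=> x; apply: coordP => n.
    by rewrite /coord/= -!/(coord _ _) -X_actM mulVg X_act1.
  - move=> x; apply: coordP => n.
    by rewrite /coord/= -!/(coord _ _) -X_actM mulgV X_act1.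
have clF : closure_Phi phi (mk_homeo hF) by apply/closure_PhiP => n; exists (a n).
by exists (exist (fun h => h \in closure_Phi phi) _ (mem_set clF)).
Qed.

Lemma Gamma_hat_nbhsP (f : Gamma_hat phi) (P : set (Gamma_hat phi)) :
  nbhs f P <-> exists n, forall f' g, acts_as n f g -> acts_as n f' g -> P f'.
Proof.
split.
  case=> _ [[Q oQ <-] Qf QP].
  have /homeo_nbhsP[n nQ] : nbhs (\val f) Q by exact: open_nbhs_nbhs.
  by exists n => f' g fg fg'; apply/QP/nQ => x; rewrite fg fg'.
move=> [n nP].
have [V [oV Vf VP]] : exists V : set (homeo (X_lim phi)), [/\ open V, V (\val f) &
    V `<=` [set h | forall x, coord n (homeo_fun (val f) x) = coord n (h x)]].
  suff : nbhs (\val f : homeo (X_lim phi))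
     [set h | forall x, coord n (homeo_fun (val f) x) = coord n (h x)].
    by rewrite nbhsE => -[V [oV Vf] VP]; exists V.
  by apply/homeo_nbhsP; exists n.
exists (set_val @^-1` V); split => //; first by exists V.
move=> f' /VP/= ff'; have [g fg] := acts_as_exists f n.
by apply: (nP _ g) => // x; rewrite -ff' fg.
Qed.

(** * The induced endomorphism *)

(** Continuity and compatibility with phi in one formula: psi f is the limit of
    the phi(g) as g in G tends to f. *)
Definition continuous_extension (psi : Gamma_hat phi -> Gamma_hat phi) : Prop :=
  forall n, exists m, forall f g, acts_as m f g -> acts_as n (psi f) (phi g).

Lemma continuous_extension_exists :
  finitely_generated G -> injective phi -> finite_index (range phi) ->
  exists psi : {multiplicative Gamma_hat phi -> Gamma_hat phi},
    continuous_extension psi.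
Proof.
move=> fgG phi_inj finI.
have [M MP] := choice (fun n => phi_uniformly_continuous n fgG phi_inj finI).
have ext f : exists F : Gamma_hat phi,
    forall n g, acts_as (M n) f g -> acts_as n F (phi g).
  have [a aP] := choice (fun n => acts_as_common (M n) (M n.+1) f).
  have [n|F FP] := @Gamma_hat_complete (fun n => phi (a n)).
    have [[_ an1] [aS _]] := (aP n, aP n.+1).
    exact/same_action_pred/MP/(acts_as_same an1 aS).
  exists F => n g fg; apply: same_acts_as (FP n).
  by apply: MP; apply: acts_as_same fg; have [] := aP n.
have [psi psiP] := choice ext.
have psiM : {morph psi : f f' / f * f'}.
  move=> f f'; apply: acts_as_eq => n.
  have [g fg] := acts_as_exists f (M n).
  have [g' fg'] := acts_as_exists f' (M n).
  exists (phi g * phi g'); split; last by apply: acts_asM; exact: psiP.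
  by rewrite -gmulfM; apply/psiP/acts_asM.
pose mpsi := isMultiplicative.Build _ _ psi psiM.
pose Psi : {multiplicative Gamma_hat phi -> Gamma_hat phi} := HB.pack psi mpsi.
by exists Psi => n; exists (M n) => f g; exact: psiP.
Qed.

Section Extension.
Variable psi : Gamma_hat phi -> Gamma_hat phi.
Hypothesis psi_ext : continuous_extension psi.

Lemma continuous_extension_continuous : continuous psi.
Proof.
move=> f U /Gamma_hat_nbhsP[n nU]; have [m mP] := psi_ext n.
apply/Gamma_hat_nbhsP; exists m => f' g fg fg'.
by apply: (nU _ (phi g)); exact: mP.
Qed.

Lemma continuous_extension_Phi g : psi (Phi_hat phi g) = Phi_hat phi (phi g).
Proof.
apply: acts_as_eq => n; have [m mP] := psi_ext n; exists (phi g).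
by split; [apply/mP/acts_as_Phi|exact: acts_as_Phi].
Qed.

Lemma continuous_extension_inj : injective phi -> injective psi.
Proof.
move=> phi_inj f f' ff'; apply: acts_as_eq => n; have [m mP] := psi_ext n.+1.
have [g [gm gn]] := acts_as_common m n f.
have [g' [gm' gn']] := acts_as_common m n f'.
exists g; split=> //; apply: same_acts_as gn'.
apply: same_action_of_image phi_inj _.
by apply: acts_as_same (mP _ _ gm') _; rewrite -ff'; exact: mP.
Qed.

(** If F fixes the base coset of X_1, then the elements of G acting as F on
    X_(n+1) lie in phi(G); their preimages under phi are coherent since phi can
    be cancelled at the cost of one level, and their limit is a preimage of F. *)
Lemma range_continuous_extension : injective phi ->
  range psi =
    [set F | coord 1 (homeo_fun (val F) (coset_pt 1)) = coord 1 (coset_pt 1)].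
Proof.
move=> phi_inj; apply/seteqP; split=> [_ [f _ <-]|F /= Fb].
  have [m mP] := psi_ext 1%N; have [g fg] := acts_as_exists f m.
  rewrite /= (mP _ _ fg) !coord_pt X_actE mulg1.
  by apply/esym/X_eqP; rewrite invg1 mul1g; exists g.
have [h hP] := choice (fun n => acts_as_exists F n.+1).
have h_image n : exists a, phi a = h n.
  have F1 := @acts_as_le 1 n.+1 _ _ isT (hP n).
  move: Fb; rewrite F1 !coord_pt X_actE mulg1 => /esym/X_eqP.
  by rewrite invg1 mul1g => -[a _ ah]; exists a.
have [a aP] := choice h_image.
have [n|f fP] := @Gamma_hat_complete a.
  apply: same_action_of_image phi_inj _; rewrite !aP.
  by apply: acts_as_same (hP n) _; apply: acts_as_le (hP n.+1).
exists f => //; apply: acts_as_eq => n; have [m mP] := psi_ext n.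
exists (h (maxn m n)); split.
  by rewrite -aP; apply: mP; apply: acts_as_le (fP _); exact: leq_maxl.
by apply: acts_as_le (hP _); exact/leqW/leq_maxr.
Qed.

End Extension.

Lemma clopen_stabilizer n (x : X_lim phi) (c : X_ phi n) :
  clopen [set F : Gamma_hat phi | coord n (homeo_fun (val F) x) = c].
Proof.
split.
  rewrite openE => F /= Fx; apply/Gamma_hat_nbhsP; exists n => F' g Fg F'g.
  by rewrite /= F'g -Fg.
move=> F clF; have [g Fg] := acts_as_exists F n.
have [|F' [/= F'x F'g]] := clF [set F' | acts_as n F' g].
  apply/Gamma_hat_nbhsP; exists n => F' g' Fg' F'g' y.
  by rewrite F'g' -Fg' Fg.
by rewrite /= Fg -F'g.
Qed.

End Renormalization.

Theorem theorem1p3 (G : groupType) (phi : {multiplicative G -> G}) :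
  finitely_generated G -> renormalization phi ->
  exists psi : {multiplicative Gamma_hat phi -> Gamma_hat phi},
    [/\ injective psi, subgroup (range psi), clopen (range psi),
        continuous psi &
        forall g : G, psi (Phi_hat phi g) = Phi_hat phi (phi g)].
Proof.
move=> fgG [phi_inj _ finI].
have [psi psi_ext] := continuous_extension_exists fgG phi_inj finI.
exists psi; split.
- exact: continuous_extension_inj psi_ext phi_inj.
- exact: subgroup_range.
- rewrite (range_continuous_extension psi_ext phi_inj); exact: clopen_stabilizer.
- exact: continuous_extension_continuous psi_ext.
- exact: continuous_extension_Phi psi_ext.
Qed.
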